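(* Let $A$ be a finite set. The final $A$-ary comagma in the category of abstract convex spaces (equivalently, of algebras for the finitely supported discrete distribution monad $\mathsf D$ on sets) is the set $\mathcal R(\mathrm{Stream}(A))$ of (necessarily Radon) Borel probability measures on $\mathrm{Stream}(A)$, endowed with the usual convex space structure $r(\omega,\omega')=r\omega+(1-r)\omega'$ and with the comagma structure $$\mathcal R(\mathrm{Stream}(A))\xrightarrow{(\mathsf{hd},\mathsf{tl})_!}\mathcal R(A\times\mathrm{Stream}(A))\xrightarrow{\cong}\mathcal R(\mathrm{Stream}(A))\star\cdots\star\mathcal R(\mathrm{Stream}(A))$$ ($A$ copies); explicitly, the comagma structure is $$\omega\mapsto\sum_{a\in A,\ \omega([a])\ne0}\omega([a])\cdot\iota_a(\overline{\omega_a}),$$ where $\overline{\omega_a}$ is the probability measure with $\overline{\omega_a}([a_1a_2\cdots a_n])=\omega([aa_1a_2\cdots a_n])/\omega([a])$.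
   Context: $\mathrm{Stream}(A)=A^{\mathbb N}$ with the product topology, $A$ discrete; $[a_0\cdots a_k]\subseteq\mathrm{Stream}(A)$ is the clopen set of streams with initial segment $a_0,\dots,a_k$ (and $[\,]$ is the whole space). $(\mathsf{hd},\mathsf{tl})\colon\mathrm{Stream}(A)\to A\times\mathrm{Stream}(A)$ sends $(a_0,a_1,\dots)$ to $(a_0,(a_1,a_2,\dots))$, and $(\;)_!$ denotes pushforward of measures. An abstract convex space is a set $X$ with an operation $(0,1)\times X\times X\to X$, $(r,x,y)\mapsto r(x,y)$, such that (writing $r^*=1-r$) $r(x,x)=x$, $r(x,y)=r^*(y,x)$ and $r(s(x,y),z)=(rs)\bigl(x,\tfrac{rs^*}{(rs)^*}(y,z)\bigr)$; maps are functions preserving the operations. These are the algebras for the monad $\mathsf D$ of finitely supported probability distributions. The coproduct of abstract convex spaces is denoted $\star$. The $A$-fold coproduct $X\star\cdots\star X$ has as elements the formal convex combinations $\sum_{a\in A'}p_a\cdot\iota_a(x_a)$, where $A'\subseteq A$ is non-empty, $p_a\in(0,1]$ with $\sum_{a\in A'}p_a=1$, and $x_a\in X$; convex combinations are formed by expanding formally and evaluating the terms with the same index $a$ in $X$. An $A$-ary comagma in a category with finite coproducts is an object $X$ with a map $X\to\sum_{a\in A}X$ (here $X\to X\star\cdots\star X$, $A$ copies); a homomorphism is a map commuting with the structure maps. ''Final'' means terminal in the category of $A$-ary comagmas and homomorphisms. *)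

(* Defs.v *)
From HB Require Import structures.
From mathcomp Require Import all_boot all_order all_algebra.
From mathcomp Require Import interval_inference ring lra.
From mathcomp Require unstable.
From mathcomp Require Import all_classical all_reals all_analysis.

Set Implicit Arguments.
Unset Strict Implicit.
Unset Printing Implicit Defensive.

Import Order.TTheory GRing.Theory Num.Theory.
Import numFieldNormedType.Exports.

Local Open Scope classical_set_scope.
Local Open Scope ring_scope.
Local Open Scope convex_scope.

(* Abstract convex spaces are the convType's of the library: there the
   operation x <| r |> y, which stands for r x + (1 - r) y, is indexed by the
   closed interval [0, 1], the values at the endpoints being forced (conv0,
   conv1).  The factory below and the lemma convA_open show that this amounts
   to the presentation by operations indexed by the open interval (0, 1). *)
HB.factory Record isOpenConvexSpace (R : realFieldType) T & Choice T := {
  oconv : R -> T -> T -> T;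
  oconvmm : forall r x, 0 < r < 1 -> oconv r x x = x;
  oconvC : forall r x y, 0 < r < 1 -> oconv r x y = oconv (1 - r) y x;
  oconvA : forall r s x y z, 0 < r < 1 -> 0 < s < 1 ->
    oconv r (oconv s x y) z =
    oconv (r * s) x (oconv (r * (1 - s) / (1 - r * s)) y z)
}.

HB.builders Context R T & isOpenConvexSpace R T.

Let cc (r : {i01 R}) (x y : T) :=
  if r%:num == 0 then y else if r%:num == 1 then x else oconv r%:num x y.

Let i01P (r : {i01 R}) : [\/ r%:num = 0, r%:num = 1 | 0 < r%:num < 1].
Proof.
have [->|r0] := eqVneq r%:num 0; first by constructor 1.
have [->|r1] := eqVneq r%:num 1; first by constructor 2.
by constructor 3; rewrite !lt_neqAle r1 eq_sym r0 ge0 le1.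
Qed.

Let cc0 r x y : r%:num = 0 -> cc r x y = y.
Proof. by rewrite /cc => ->; rewrite eqxx. Qed.

Let cc1 r x y : r%:num = 1 -> cc r x y = x.
Proof. by rewrite /cc => ->; rewrite oner_eq0 eqxx. Qed.

Let cco (r : {i01 R}) x y : 0 < r%:num < 1 -> cc r x y = oconv r%:num x y.
Proof. by rewrite /cc => /andP[r0 r1]; rewrite gt_eqF// lt_eqF. Qed.

Let ccT a b : cc 1%:i01 a b = a.
Proof. exact: cc1. Qed.

Let ccmm r a : cc r a a = a.
Proof. by case: (i01P r) => [/cc0|/cc1|r01]//; rewrite cco// oconvmm. Qed.

Let ccC r a b : cc r a b = cc (1 - r%:num)%:i01 b a.
Proof.
case: (i01P r) => [r0|r1|r01].
- by rewrite cc0// cc1//= r0 subr0.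
- by rewrite cc1// cc0//= r1 subrr.
- by rewrite !cco//= 1?oconvC//; move: r01; lra.
Qed.

Let ccA : convex_quasi_associative cc.
Proof.
move=> p q r s a b c prs spq; rewrite /unstable.onem in spq.
case: (i01P s) => [s0|s1|s01].
- rewrite (cc0 _ _ s0) cc0; last by rewrite prs s0 mulr0.
  rewrite cc0//; move: spq; rewrite prs s0 mulr0; lra.
- rewrite (cc1 _ _ s1); have pr : p%:num = r%:num by rewrite prs s1 mulr1.
  have /eqP : (1 - p%:num) * (1 - q%:num) = 0 by rewrite -spq s1 subrr.
  rewrite mulf_eq0 => /orP[|] /eqP pq0.
    by rewrite cc1 ?cc1//; move: pq0; lra.
  rewrite [cc q _ _]cc1; last by move: pq0; lra.
  by rewrite /cc pr.
have p1 : 0 < 1 - p%:num.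
  rewrite subr_gt0 lt_neqAle le1 andbT; apply/eqP => p1.
  by move: spq s01; rewrite p1; lra.
case: (i01P r) => [r0|r1|r01].
- rewrite cc0 ?prs ?r0 ?mul0r// (cc0 _ _ r0).
  have e : s%:num = q%:num by move: spq; rewrite prs r0 mul0r; lra.
  by rewrite /cc e.
- have ps : p%:num = s%:num by rewrite prs r1 mul1r.
  have q0 : q%:num = 0.
    by apply: (mulfI (lt0r_neq0 p1)); move: spq; rewrite ps; lra.
  by rewrite (cc1 _ _ r1) (cc0 _ _ q0) /cc ps.
have p0 : 0 < p%:num by rewrite prs mulr_gt0//; lra.
have qE : q%:num = s%:num * (1 - r%:num) / (1 - s%:num * r%:num).
  rewrite [s%:num * r%:num]mulrC -prs.
  by apply: (canRL (mulfK (lt0r_neq0 p1))); move: spq prs; nra.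
have q01 : 0 < q%:num < 1.
  rewrite !lt_neqAle ge0 le1 !andbT eq_sym; apply/andP; split; apply/eqP => q0.
    by move: spq prs s01 r01; rewrite q0; nra.
  by move: spq s01; rewrite q0; lra.
rewrite (cco a _ _); last by move: p0 p1; lra.
rewrite (cco _ _ q01) (cco _ _ s01) (cco _ _ r01) oconvA//.
by rewrite -qE [s%:num * r%:num]mulrC -prs.
Qed.

HB.instance Definition _ := @isConvexSpace.Build R T cc ccT ccmm ccC ccA.

HB.end.

Lemma convA_open (R : realFieldType) (X : convType R) (r s t u : {i01 R})
    (x y z : X) : 0 < r%:num < 1 -> 0 < s%:num < 1 ->
  t%:num = r%:num * s%:num ->
  u%:num = r%:num * (1 - s%:num) / (1 - r%:num * s%:num) ->
  (x <|s|> y) <|r|> z = x <|t|> (y <|u|> z).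
Proof.
move=> r01 s01 tE uE; apply/esym/convA; first by rewrite mulrC.
have rs1 : r%:num * s%:num < 1 by move: r01 s01; nra.
by rewrite /unstable.onem tE uE; field; rewrite subr_eq0 eq_sym lt_eqF.
Qed.

Definition affine (R : realType) (X Y : convType R) (f : X -> Y) :=
  forall (r : {i01 R}) x y, f (x <|r|> y) = f x <|r|> f y.

(* A summand of a formal convex combination: Some (p, x) is the term p . x,
   with p > 0, and None stands for an index outside of the support. *)
Section summands.
Context {R : realType}.
Implicit Types X Y : Type.

Definition summand X := option ({posnum R} * X).

Definition weight X (t : summand X) : R := if t is Some (p, _) then p%:num else 0.

Definition smap X Y (f : X -> Y) (t : summand X) : summand Y :=
  omap (fun px => (px.1, f px.2)) t.

Definition sscale X (r : R) (t : summand X) : summand X :=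
  if t is Some (p, x) then
    if @idP (0 < r * p%:num) is ReflectT h then Some (PosNum h, x) else None
  else None.

Lemma frac_ge0 (p q : {posnum R}) : 0 <= p%:num / (p%:num + q%:num).
Proof. by []. Qed.

Lemma frac_le1 (p q : {posnum R}) : p%:num / (p%:num + q%:num) <= 1.
Proof. by rewrite ler_pdivrMr// mul1r lerDl. Qed.

Definition frac p q : {i01 R} := Itv01 (frac_ge0 p q) (frac_le1 p q).

(* p . x + q . y = (p + q) . (p/(p+q) x + q/(p+q) y) *)
Definition sadd (X : convType R) (t u : summand X) : summand X :=
  match t, u with
  | None, _ => u
  | _, None => t
  | Some (p, x), Some (q, y) =>
      Some ((p%:num + q%:num)%:pos, x <|frac p q|> y)
  end.

Lemma summandP X (t u : summand X) :
  weight t = weight u ->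
  (forall p q x y, t = Some (p, x) -> u = Some (q, y) -> p%:num = q%:num ->
    x = y) ->
  t = u.
Proof.
case: t u => [[p x]|] [[q y]|]//=.
- move=> pq /(_ _ _ _ _ erefl erefl pq) ->.
  by have -> : p = q by exact/val_inj.
- by move=> p0; have : 0 < p%:num by []; rewrite p0 ltxx.
- by move=> p0; have : 0 < q%:num by []; rewrite -p0 ltxx.
Qed.

Lemma weight_ge0 X (t : summand X) : 0 <= weight t.
Proof. by case: t => [[p x]|]/=. Qed.

Lemma weight_eq0 X (t : summand X) : weight t = 0 -> t = None.
Proof.
by case: t => [[p x]|]//= p0; have : 0 < p%:num by []; rewrite p0 ltxx.
Qed.

Lemma weight_smap X Y (f : X -> Y) t : weight (smap f t) = weight t.
Proof. by case: t => [[]|]. Qed.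

Lemma weight_sscale X r (t : summand X) :
  0 <= r -> weight (sscale r t) = r * weight t.
Proof.
case: t => [[p x]|]/= r0; last by rewrite mulr0.
case: {-}_ / idP => //= /negP; rewrite -leNgt => rp0.
by apply/eqP; rewrite eq_le rp0 mulr_ge0.
Qed.

Lemma sscale0 X (t : summand X) : sscale 0 t = None.
Proof. by apply: weight_eq0; rewrite weight_sscale// mul0r. Qed.

Lemma sscaleE X r (p : {posnum R}) (x : X) : 0 < r ->
  exists2 q : {posnum R}, q%:num = r * p%:num & sscale r (Some (p, x)) = Some (q, x).
Proof.
move=> r0 /=; case: {-}_ / idP => [h|]; first by exists (PosNum h).
by rewrite mulr_gt0.
Qed.

Lemma sscale1 X (t : summand X) : sscale 1 t = t.
Proof.
case: t => [[p x]|]//; have [q qE ->] := sscaleE p x ltr01.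
by apply: summandP => [|????]/=; [rewrite qE mul1r|move=> [_ <-] [_ <-]].
Qed.

Lemma sscaleM X r s (t : summand X) : 0 <= r -> 0 <= s ->
  sscale r (sscale s t) = sscale (r * s) t.
Proof.
rewrite le_eqVlt => /orP[/eqP <- _|r0]; first by rewrite mul0r !sscale0.
rewrite le_eqVlt => /orP[/eqP <-|s0]; first by rewrite mulr0 !sscale0.
case: t => [[p x]|]//; have [q qE ->] := sscaleE p x s0.
have [q' qE' ->] := sscaleE q x r0.
have [q2 qE2 ->] := sscaleE p x (mulr_gt0 r0 s0).
apply: summandP => [|????]/=; last by move=> [_ <-] [_ <-].
by rewrite qE' qE qE2 mulrA.
Qed.

Lemma smap_sscale X Y (f : X -> Y) r t :
  smap f (sscale r t) = sscale r (smap f t).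
Proof. by case: t => [[p x]|]//=; case: {-}_ / idP. Qed.

Section sadd_theory.
Variable X : convType R.
Implicit Types t u v : summand X.

Lemma weight_sadd t u : weight (sadd t u) = weight t + weight u.
Proof. by case: t u => [[p x]|] [[q y]|]/=; rewrite ?addr0 ?add0r. Qed.

Lemma sadd0s : left_id None (@sadd X). Proof. by case. Qed.

Lemma sadds0 : right_id None (@sadd X). Proof. by case=> [[]|]. Qed.

Lemma saddC : commutative (@sadd X).
Proof.
move=> t u; apply: summandP; first by rewrite !weight_sadd addrC.
case: t u => [[p x]|] [[q y]|]//= p' q' x' y'; do 1?by move=> -[_ <-] [_ <-].
move=> -[_ <-] [_ <-] _; rewrite convC; congr (_ <|_|> _); apply/val_inj => /=.
by field; rewrite gt_eqF.
Qed.

Lemma saddA : associative (@sadd X).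
Proof.
move=> t u v; apply: summandP; first by rewrite !weight_sadd addrA.
case: t u v => [[p x]|] [[q y]|] [[r z]|]//= p' q' x' y';
  do 1?by move=> -[_ <-] [_ <-].
move=> -[_ <-] [_ <-] _; apply: convA => /=.
  by field; rewrite !gt_eqF.
by rewrite /unstable.onem; field; rewrite !gt_eqF.
Qed.

HB.instance Definition _ :=
  Monoid.isComLaw.Build (summand X) None (@sadd X) saddA saddC sadd0s.

Lemma sscaleDl r s t : 0 <= r -> 0 <= s ->
  sscale (r + s) t = sadd (sscale r t) (sscale s t).
Proof.
move=> r0' s0'; move: (r0') (s0').
rewrite le_eqVlt => /orP[/eqP <- _|r0]; first by rewrite sscale0 add0r sadd0s.
rewrite le_eqVlt => /orP[/eqP <-|s0].
  by rewrite sscale0 addr0 sadds0.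
case: t => [[p x]|]//; apply: summandP.
  by rewrite weight_sadd !weight_sscale ?addr_ge0// mulrDl.
have [q qE ->] := sscaleE p x s0.
have [q' qE' ->] := sscaleE p x r0.
have [q2 qE2 ->] := sscaleE p x (addr_gt0 r0 s0).
by move=> p1 p2 x1 x2 /= [_ <-] [_ <-] _; rewrite convmm.
Qed.

Lemma sscaleDr r t u : 0 <= r ->
  sscale r (sadd t u) = sadd (sscale r t) (sscale r u).
Proof.
rewrite le_eqVlt => /orP[/eqP <-|r0]; first by rewrite !sscale0.
apply: summandP.
  by rewrite weight_sadd !weight_sscale ?ltW// weight_sadd mulrDr.
case: t u => [[p x]|] [[q y]|].
- have [p' pE ->] := sscaleE p x r0; have [q' qE ->] := sscaleE q y r0.
  rewrite [sadd _ _]/=.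
  have [s sE ->] := sscaleE (p%:num + q%:num)%:pos (x <|frac p q|> y) r0.
  move=> p1 p2 x1 x2 /= [_ <-] [_ <-] _; congr (_ <|_|> _); apply/val_inj => /=.
  by rewrite pE qE; field; rewrite !gt_eqF ?addr_gt0 ?mulr_gt0.
- by rewrite !sadds0 => p1 p2 x1 x2 -> [_ <-].
- by rewrite !sadd0s => p1 p2 x1 x2 -> [_ <-].
- by [].
Qed.

Lemma sadd_conv (r : {i01 R}) (x y : X) : Some (1%:pos, x <|r|> y) =
  sadd (sscale r%:num (Some (1%:pos, x))) (sscale (1 - r%:num) (Some (1%:pos, y))).
Proof.
have [r0|r0] := eqVneq r%:num 0.
  rewrite r0 sscale0 subr0 sscale1 sadd0s.
  by rewrite (_ : r = 0%:i01) ?conv0//; exact/val_inj.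
have [r1|r1] := eqVneq r%:num 1.
  rewrite r1 subrr sscale0 sscale1 sadds0.
  by rewrite (_ : r = 1%:i01) ?conv1//; exact/val_inj.
have r_gt0 : 0 < r%:num by rewrite lt_neqAle eq_sym r0 ge0.
have r_lt1 : 0 < 1 - r%:num by rewrite subr_gt0 lt_neqAle r1 le1.
have [p pE ->] := sscaleE 1%:pos x r_gt0.
have [q qE ->] := sscaleE 1%:pos y r_lt1.
apply: summandP => [|p' q' x' y' /= [_ <-] [_ <-] _] /=; first by rewrite pE qE/=; ring.
congr (_ <|_|> _); apply/val_inj => /=.
by rewrite pE qE /= !mulr1 subrKC divr1.
Qed.

End sadd_theory.

Lemma smap_sadd (X Y : convType R) (f : X -> Y) t u : affine f ->
  smap f (sadd t u) = sadd (smap f t) (smap f u).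
Proof. by case: t u => [[p x]|] [[q y]|]//= ->. Qed.

End summands.

(* The A-fold coproduct of X with itself: formal convex combinations
   sum_(a in A') p_a . iota_a(x_a), encoded by the function on A which sends
   a in A' to Some (p_a, x_a) and the other indices to None.  Convex
   combinations are formed index by index.  The injections iota_a are called
   coprod_in; the universal property is given by copair_in, copair_affine and
   coprod_ext. *)
Section coprod.
Context {R : realType}.

Record coprod (A : finType) (X : Type) := Coprod {
  summands :> A -> @summand R X;
  weight_summands : \sum_a weight (summands a) = 1
}.

Lemma coprodP A X (t u : coprod A X) : (forall a, t a = u a) -> t = u.
Proof.
case: t u => [t t1] [u u1]/= /funext tu; rewrite tu in t1 *.
by congr Coprod; exact: Prop_irrelevance.
Qed.

HB.instance Definition _ A X := gen_eqMixin (coprod A X).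
HB.instance Definition _ A X := gen_choiceMixin (coprod A X).

Section coprod_conv.
Variables (A : finType) (X : convType R).
Implicit Types t u : coprod A X.

Definition coprod_conv_fun (r : {i01 R}) t u a :=
  sadd (sscale r%:num (t a)) (sscale (1 - r%:num) (u a)).

Lemma coprod_conv_subproof r t u :
  \sum_a weight (coprod_conv_fun r t u a) = 1.
Proof.
under eq_bigr do rewrite weight_sadd !weight_sscale ?subr_ge0//.
by rewrite big_split/= -!mulr_sumr !weight_summands; ring.
Qed.

Definition coprod_conv r t u := Coprod (coprod_conv_subproof r t u).

Lemma coprod_conv1 t u : coprod_conv 1%:i01 t u = t.
Proof.
by apply: coprodP => a /=; rewrite /coprod_conv_fun/= subrr sscale0 sscale1 sadds0.
Qed.

Lemma coprod_convmm r t : coprod_conv r t t = t.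
Proof.
apply: coprodP => a /=; rewrite /coprod_conv_fun -sscaleDl ?subr_ge0//.
by rewrite subrKC sscale1.
Qed.

Lemma coprod_convC r t u :
  coprod_conv r t u = coprod_conv (1 - r%:num)%:i01 u t.
Proof.
by apply: coprodP => a /=; rewrite /coprod_conv_fun/= saddC subKr.
Qed.

Lemma coprod_convA : convex_quasi_associative coprod_conv.
Proof.
move=> p q r s t u v prs spq; apply: coprodP => a /=; rewrite /coprod_conv_fun/=.
rewrite !sscaleDr ?subr_ge0// !sscaleM ?subr_ge0// saddA prs mulrC.
congr (sadd (sadd _ _) _); rewrite -?spq//.
  by congr sscale; move: spq; rewrite /unstable.onem prs; lra.
by congr sscale; move: spq; rewrite /unstable.onem prs; lra.
Qed.

HB.instance Definition _ := isConvexSpace.Build R (coprod A X)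
  coprod_conv1 coprod_convmm coprod_convC coprod_convA.

End coprod_conv.

Lemma coprod_in_subproof (A : finType) X (a : A) (x : X) :
  \sum_b weight (if b == a then Some (1%:pos, x) : @summand R X else None) = 1.
Proof. by rewrite (bigD1 a)//= eqxx/= big1 ?addr0// => b /negPf ->. Qed.

Definition coprod_in (A : finType) X (a : A) (x : X) : coprod A X := Coprod (coprod_in_subproof a x).

Lemma coprod_map_subproof (A : finType) X Y (h : X -> Y) (t : coprod A X) :
  \sum_a weight (smap h (t a)) = 1.
Proof. by under eq_bigr do rewrite weight_smap; exact: weight_summands. Qed.

(* h * ... * h *)
Definition coprod_map (A : finType) X Y (h : X -> Y) (t : coprod A X) :
  coprod A Y := Coprod (coprod_map_subproof h t).

Section copair.
Variables (A : finType) (X Y : convType R) (f : A -> X -> Y).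

Definition copair_sum (t : coprod A X) : summand Y :=
  \big[@sadd R Y/None]_a smap (f a) (t a).

Lemma weight_copair_sum t : weight (copair_sum t) = 1.
Proof.
rewrite -(weight_summands t) /copair_sum.
rewrite (big_morph (@weight R Y) (@weight_sadd R Y) erefl).
by apply: eq_bigr => a _; rewrite weight_smap.
Qed.

Lemma copair_subproof t : exists y, omap snd (copair_sum t) = Some y.
Proof.
case E : (copair_sum t) => [[p y]|]; first by exists y.
by have := weight_copair_sum t; rewrite E => /esym/eqP; rewrite oner_eq0.
Qed.

(* The copairing: sum_a p_a . iota_a x_a is sent to sum_a p_a (f a x_a). *)
Definition copair t : Y := projT1 (cid (copair_subproof t)).

Lemma copairE t : copair_sum t = Some (1%:pos, copair t).
Proof.
rewrite /copair; case: cid => y /=; have := weight_copair_sum t.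
case: (copair_sum t) => [[p z]|]//= p1 [->]; congr (Some (_, _)).
exact/val_inj.
Qed.

Lemma coprod_inE (a b : A) (x : X) :
  coprod_in a x b = if b == a then Some (1%:pos, x) else None.
Proof. by []. Qed.

Lemma copair_in a x : copair (coprod_in a x) = f a x.
Proof.
have := copairE (coprod_in a x).
rewrite /copair_sum (bigD1 a)//= eqxx big1 ?sadds0; first by case.
by move=> b /negPf ->.
Qed.

Hypothesis f_affine : forall a, affine (f a).

Lemma copair_affine : affine copair.
Proof.
move=> r t u; have := copairE (t <|r|> u).
have -> : copair_sum (t <|r|> u) =
    sadd (sscale r%:num (copair_sum t)) (sscale (1 - r%:num) (copair_sum u)).
  rewrite /copair_sum.
  under eq_bigr do rewrite /= /coprod_conv_fun smap_sadd// !smap_sscale.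
  have sbig r' (F : A -> summand Y) : 0 <= r' ->
      \big[@sadd R Y/None]_a sscale r' (F a) =
      sscale r' (\big[@sadd R Y/None]_a F a).
    move=> r0; apply/esym.
    exact: (big_morph (sscale r') (fun t u => sscaleDr t u r0) erefl).
  by rewrite big_split/= !sbig ?subr_ge0.
by rewrite !copairE -sadd_conv => -[<-].
Qed.

End copair.

Lemma coprod_ext (A : finType) (X Y : convType R) (g h : coprod A X -> Y) :
  affine g -> affine h -> (forall a x, g (coprod_in a x) = h (coprod_in a x)) ->
  g =1 h.
Proof.
move=> ga ha gh t.
have [n] := ubnP #|[pred a | weight (t a) != 0]|.
elim: n t => // n IH t tn.
have [a ta] : exists a, weight (t a) != 0.
  apply/existsP; rewrite -negb_forall; apply/negP => /forallP t0.
  have /eqP := weight_summands t; rewrite big1 1?eq_sym ?oner_eq0// => a _.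
  exact/eqP.
case E : (t a) ta => [[p x]|]/= p0; last by rewrite eqxx in p0.
have sumE : p%:num + \sum_(b | b != a) weight (t b) = 1.
  by have := weight_summands t; rewrite (bigD1 a)//= E.
have s0 : 0 <= \sum_(b | b != a) weight (t b).
  by apply: sumr_ge0 => b _; exact: weight_ge0.
have [p1|p1] := eqVneq p%:num 1.
  have -> : t = coprod_in a x; last exact: gh.
  apply: coprodP => b; rewrite coprod_inE; case: eqVneq => [->|ba].
    by rewrite E; congr (Some (_, _)); exact/val_inj.
  apply: weight_eq0; apply/eqP; rewrite eq_le weight_ge0 andbT.
  have <- : \sum_(b | b != a) weight (t b) = 0 by move: sumE; rewrite p1; lra.
  by rewrite (bigD1 b)//= lerDl; apply: sumr_ge0 => c _; exact: weight_ge0.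
have p_lt1 : 0 < 1 - p%:num.
  by rewrite subr_gt0 lt_neqAle p1/=; move: sumE s0; lra.
pose u b := if b == a then None else sscale (1 - p%:num)^-1 (t b).
have u1 : \sum_b weight (u b) = 1.
  rewrite (bigD1 a)//= /u eqxx/= add0r.
  under eq_bigr => b /negPf -> do rewrite weight_sscale ?invr_ge0 ?ltW//.
  rewrite -mulr_sumr; have -> : \sum_(b | b != a) weight (t b) = 1 - p%:num.
    by move: sumE; lra.
  by rewrite mulVf// gt_eqF.
have ple1 : p%:num <= 1 by move: p_lt1; lra.
have pgt0 : 0 < p%:num by [].
pose r : {i01 R} := Itv01 (ltW pgt0) ple1.
have -> : t = coprod_in a x <|r|> Coprod u1.
  apply: coprodP => b; rewrite /= /coprod_conv_fun/= /u; case: eqVneq => [->|ba].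
    have [q qE ->] := sscaleE 1%:pos x pgt0.
    rewrite sadds0 E; congr (Some (_, _)); apply/val_inj => /=.
    by rewrite qE mulr1.
  by rewrite sadd0s sscaleM ?invr_ge0 ?ltW// mulfV ?gt_eqF// sscale1.
rewrite ga ha gh IH//; move: tn; rewrite ltnS; apply: leq_trans.
apply/proper_card/properP; split.
  apply/fintype.subsetP => b; rewrite !inE /= /u; have [->|ba] := eqVneq b a.
    by rewrite eqxx.
  rewrite weight_sscale ?invr_ge0 ?ltW//.
  by apply: contra_neq => ->; rewrite mulr0.
by exists a; rewrite inE /= ?E// /u eqxx/= eqxx.
Qed.

Lemma coprod_in_affine (A : finType) (X : convType R) a :
  affine (@coprod_in A X a).
Proof.
move=> r x y; apply: coprodP => b; rewrite /= /coprod_conv_fun.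
have [->|ba] := eqVneq b a; last by rewrite !coprod_inE (negPf ba).
rewrite !coprod_inE eqxx.
exact: sadd_conv.
Qed.

Lemma coprod_map_affine (A : finType) (X Y : convType R) (h : X -> Y) :
  affine h -> affine (@coprod_map A X Y h).
Proof.
move=> ha r t u; apply: coprodP => a.
by rewrite /= /coprod_conv_fun smap_sadd// !smap_sscale.
Qed.

Lemma coprod_map_in (A : finType) (X Y : convType R) (h : X -> Y) a x :
  coprod_map h (@coprod_in A X a x) = coprod_in a (h x).
Proof. by apply: coprodP => b /=; case: eqP. Qed.

End coprod.

Record comagma (R : realType) (A : finType) := Comagma {
  comagma_sort :> convType R;
  costruct : comagma_sort -> coprod A comagma_sort;
  costruct_affine : affine costruct
}.

Definition comagma_hom (R : realType) (A : finType) (C D : comagma R A)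
    (h : C -> D) :=
  affine h /\ forall x, costruct (h x) = coprod_map h (costruct x).

Definition final_comagma (R : realType) (A : finType) (D : comagma R A) :=
  forall C : comagma R A, exists! h : C -> D, comagma_hom h.

Definition borel (T : topologicalType) : set (set T) := <<s @open T >>.

Section borel.
Variable T : topologicalType.
Implicit Types B : set T.

Lemma open_borel B : open B -> borel B.
Proof. exact: sub_sigma_algebra. Qed.

Lemma borel0 : borel (@set0 T).
Proof. by apply: open_borel; exact: open0. Qed.

Lemma borelT : borel [set: T].
Proof. by apply: open_borel; exact: openT. Qed.

Lemma borelC B : borel B -> borel (~` B).
Proof. by move=> bB; rewrite -setTD; exact: sigma_algebraCD. Qed.

Lemma borel_bigcup (F : (set T)^nat) :
  (forall n, borel (F n)) -> borel (\bigcup_n F n).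
Proof. by move=> bF; exact: sigma_algebra_bigcup. Qed.

End borel.

(* The library's probability T R is not used because it requires T to be
   pointed (Stream A is empty when A is), and because two of its elements may
   differ on non-measurable sets only.  Here a measure is set to 0 outside of
   the Borel sets, so that equality is equality on Borel sets. *)
Record borel_prob (R : realType) (T : topologicalType) := BorelProb {
  bprob :> set T -> R;
  bprob_nonborel : forall B, ~ borel B -> bprob B = 0;
  bprob_ge0 : forall B, 0 <= bprob B;
  bprob_setT : bprob setT = 1;
  bprob_sigma_additive : forall F : (set T)^nat,
    (forall n, borel (F n)) -> trivIset setT F ->
    series (fun n => bprob (F n)) @ \oo --> bprob (\bigcup_n F n)
}.

Section borel_prob.
Context {R : realType}.

Lemma bprobP (T : topologicalType) (mu nu : borel_prob R T) :
  (forall B, borel B -> mu B = nu B) -> mu = nu.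
Proof.
case: mu nu => [m m1 m2 m3 m4] [n n1 n2 n3 n4]/= mn.
have {}mn : m = n.
  by apply/funext => B; have [/mn//|nB] := pselect (borel B); rewrite m1// n1.
by rewrite mn in m1 m2 m3 m4 *; congr BorelProb; exact: Prop_irrelevance.
Qed.

HB.instance Definition _ (T : topologicalType) := gen_eqMixin (borel_prob R T).
HB.instance Definition _ (T : topologicalType) :=
  gen_choiceMixin (borel_prob R T).

Section conv.
Variable T : topologicalType.
Implicit Types mu nu : borel_prob R T.

Definition bconv_fun (r : {i01 R}) mu nu B := r%:num * mu B + (1 - r%:num) * nu B.

Lemma bconv_nonborel r mu nu B : ~ borel B -> bconv_fun r mu nu B = 0.
Proof. by move=> nB; rewrite /bconv_fun !bprob_nonborel// !mulr0 addr0. Qed.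

Lemma bconv_ge0 r mu nu B : 0 <= bconv_fun r mu nu B.
Proof. by rewrite addr_ge0// mulr_ge0 ?bprob_ge0// subr_ge0. Qed.

Lemma bconv_setT r mu nu : bconv_fun r mu nu setT = 1.
Proof. by rewrite /bconv_fun !bprob_setT; ring. Qed.

Lemma bconv_sigma_additive r mu nu (F : (set T)^nat) :
  (forall n, borel (F n)) -> trivIset setT F ->
  series (fun n => bconv_fun r mu nu (F n)) @ \oo -->
    bconv_fun r mu nu (\bigcup_n F n).
Proof.
move=> bF tF.
rewrite [X in X @ _ --> _](_ : _ =
    (fun n => r%:num * series (fun n => mu (F n)) n +
              (1 - r%:num) * series (fun n => nu (F n)) n)).
  by apply: cvgD; apply: cvgM; try exact: cvg_cst;
    exact: bprob_sigma_additive.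
by apply/funext => n; rewrite /series/= big_split/= -!mulr_sumr.
Qed.

Definition bconv r mu nu := BorelProb (@bconv_nonborel r mu nu)
  (bconv_ge0 r mu nu) (bconv_setT r mu nu) (@bconv_sigma_additive r mu nu).

Lemma bconv1 mu nu : bconv 1%:i01 mu nu = mu.
Proof. by apply: bprobP => B _; rewrite /= /bconv_fun/=; ring. Qed.

Lemma bconvmm r mu : bconv r mu mu = mu.
Proof. by apply: bprobP => B _; rewrite /= /bconv_fun/=; ring. Qed.

Lemma bconvC r mu nu : bconv r mu nu = bconv (1 - r%:num)%:i01 nu mu.
Proof. by apply: bprobP => B _; rewrite /= /bconv_fun/=; ring. Qed.

Lemma bconvA : convex_quasi_associative bconv.
Proof.
move=> p q r s a b c prs spq; apply: bprobP => B _; rewrite /= /bconv_fun/=.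
rewrite /unstable.onem in spq.
rewrite !mulrDr !mulrA addrA -spq prs [s%:num * _]mulrC; congr (_ + _ * _ + _).
by move: spq; rewrite prs; lra.
Qed.

HB.instance Definition _ := isConvexSpace.Build R (borel_prob R T)
  bconv1 bconvmm bconvC bconvA.

End conv.

Definition borel_map (T U : topologicalType) (f : T -> U) :=
  forall B, borel B -> borel (f @^-1` B).

Lemma continuous_borel_map (T U : topologicalType) (f : T -> U) :
  continuous f -> borel_map f.
Proof.
move=> cf; suff : @borel U `<=` [set B | borel (f @^-1` B)] by [].
apply: smallest_sub.
  split => [|C /= bC|F bF] /=.
  - by rewrite preimage_set0; exact: borel0.
  - by rewrite setTD; exact: borelC.
  - by rewrite preimage_bigcup; exact: borel_bigcup.
move=> O oO /=; apply: open_borel.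
by apply: open_comp => // x _; exact: cf.
Qed.

Section pushforward.
Variables (T U : topologicalType) (f : T -> U).
Hypothesis bf : borel_map f.
Variable mu : borel_prob R T.

Definition push_fun B := if `[< borel B >] then mu (f @^-1` B) else 0.

Lemma pushE_subproof B : borel B -> push_fun B = mu (f @^-1` B).
Proof. by move=> bB; rewrite /push_fun asboolT. Qed.

Lemma push_nonborel B : ~ borel B -> push_fun B = 0.
Proof. by move=> nB; rewrite /push_fun asboolF. Qed.

Lemma push_ge0 B : 0 <= push_fun B.
Proof. by rewrite /push_fun; case: ifP => // _; exact: bprob_ge0. Qed.

Lemma push_setT : push_fun setT = 1.
Proof. by rewrite /push_fun asboolT ?preimage_setT ?bprob_setT//; exact: borelT. Qed.

Lemma push_sigma_additive (F : (set U)^nat) :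
  (forall n, borel (F n)) -> trivIset setT F ->
  series (fun n => push_fun (F n)) @ \oo --> push_fun (\bigcup_n F n).
Proof.
move=> bF tF.
have -> : (fun n => push_fun (F n)) = (fun n => mu (f @^-1` F n)).
  by apply/funext => n; rewrite pushE_subproof.
rewrite pushE_subproof; last exact: borel_bigcup.
rewrite preimage_bigcup; apply: bprob_sigma_additive => [n|].
  by apply: bf; exact: bF.
move/trivIsetP: tF => tF; apply/trivIsetP => i j _ _ ij.
by rewrite -preimage_setI tF// preimage_set0.
Qed.

Definition push : borel_prob R U :=
  BorelProb push_nonborel push_ge0 push_setT push_sigma_additive.

Lemma pushE B : borel B -> push B = mu (f @^-1` B).
Proof. exact: pushE_subproof. Qed.

End pushforward.

Lemma push_affine (T U : topologicalType) (f : T -> U) (bf : borel_map f) :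
  affine (push bf).
Proof.
by move=> r mu nu; apply: bprobP => B bB; rewrite pushE//= /bconv_fun !pushE.
Qed.

Definition radon (T : topologicalType) (mu : borel_prob R T) :=
  forall B, borel B ->
    mu B = sup [set mu K | K in [set K | [/\ compact K, borel K & K `<=` B]]].

End borel_prob.

Definition stream (A : finType) := {ptws nat -> discrete_topology A}.
HB.instance Definition _ (A : finType) := Topological.copy (stream A)
  {ptws nat -> discrete_topology A}.

Definition tl (A : finType) (w : stream A) : stream A := fun n => w n.+1.

Definition hdtl (A : finType) (w : stream A) : discrete_topology A * stream A :=
  (w 0%N, tl w).

(* the clopen set [a_0 ... a_k] *)
Definition cylinder (A : finType) (s : seq A) : set (stream A) :=
  [set w | mkseq w (size s) = s].

Section streams.
Context {R : realType}.
Variable A : finType.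
Local Notation dA := (discrete_topology A).
Local Notation P := (borel_prob R (stream A)).

Lemma proj_stream_continuous n : continuous (fun w : stream A => w n : dA).
Proof. exact: (@proj_continuous nat (fun=> dA) n). Qed.

Lemma cvg_stream (F : set_system (stream A)) (w : stream A) : Filter F ->
  (forall n, (fun v : stream A => v n : dA) @ F --> (w n : dA)) -> F --> w.
Proof.
move=> FF Fw; apply/cvg_sup => n U [_ [[V oV <-] /= Vw] VU].
apply: filterS VU _; apply: Fw.
exact: open_nbhs_nbhs.
Qed.

Lemma tl_continuous : continuous (@tl A).
Proof.
move=> w.
simple refine (cvg_stream (fmap_filter (@tl A) (nbhs_filter w)) _).
exact: (fun n => @proj_stream_continuous n.+1 w).
Qed.

Lemma hdtl_continuous : continuous (@hdtl A).
Proof.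
move=> w.
simple refine (@cvg_pair _ _ _ (nbhs w) _ _ (nbhs_filter w) (nbhs_filter _)
  (nbhs_filter _) _ _ (@proj_stream_continuous 0 w) (@tl_continuous w)).
Qed.

Lemma pair_continuous (a : dA) : continuous (fun w : stream A => (a, w)).
Proof.
move=> w.
simple refine (@cvg_pair _ _ _ (nbhs w) _ _ (nbhs_filter w) (nbhs_filter _)
  (nbhs_filter _) _ _ (@cvg_cst _ a _ (nbhs w) (nbhs_filter w))
  (@cvg_id _ (nbhs w))).
Qed.

(* (hd, tl)_! *)
Definition push_hdtl : P -> borel_prob R (dA * stream A)%type :=
  push (continuous_borel_map hdtl_continuous).

(* The canonical map R(S) * ... * R(S) -> R(A x S) on the coproduct, with
   components the (a, -)_! : R(S) -> R(A x S) *)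
Definition copair_push : coprod A P -> borel_prob R (dA * stream A)%type :=
  copair (fun a => push (continuous_borel_map (@pair_continuous a))).

End streams.

(* Main.v *)
(* A state x of a comagma gives each word a_1...a_n a weight: the product of
   the coefficients met when unfolding x along a_1, ..., a_n.  Such weights are
   consistent under extension of words, hence form a finitely additive content
   on the clopen sets of Stream(A); compactness makes it countably subadditive,
   and Caratheodory's theorem extends it to a Borel probability measure, the
   image of x.  Borel measures agreeing on cylinders are equal, and a
   homomorphism must send x to a measure with exactly these weights, so it is
   unique.  As the Caratheodory extension is an infimum over covers by clopen
   sets, it is outer regular, which on a compact space is the Radon property.
   The inverse of R(S) * ... * R(S) -> R(A x S) is disintegration over A. *)
From HB Require Import structures.
Require Import Defs.
From mathcomp Require Import all_boot all_order all_algebra.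
From mathcomp Require Import interval_inference ring lra.
From mathcomp Require Import all_classical all_reals all_analysis.

Set Implicit Arguments.
Unset Strict Implicit.
Unset Printing Implicit Defensive.

Import Order.TTheory GRing.Theory Num.Theory.
Import numFieldNormedType.Exports.

Local Open Scope classical_set_scope.
Local Open Scope ring_scope.
Local Open Scope convex_scope.

(** * Borel sets and Borel probability measures *)

Section borel_sets.
Variable T : topologicalType.
Implicit Types A B : set T.

Lemma borelU A B : borel A -> borel B -> borel (A `|` B).
Proof.
move=> bA bB; rewrite -bigcup2E; apply: borel_bigcup => -[|[|n]] //=.
exact: borel0.
Qed.

Lemma borelI A B : borel A -> borel B -> borel (A `&` B).
Proof.
move=> bA bB; rewrite -[_ `&` _]setCK setCI; apply: borelC.
by apply: borelU; exact: borelC.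
Qed.

Lemma borelD A B : borel A -> borel B -> borel (A `\` B).
Proof. by move=> bA bB; rewrite setDE; apply: borelI => //; exact: borelC. Qed.

Lemma borel_bigsetU (I : Type) (r : seq I) (P : pred I) (F : I -> set T) :
  (forall i, borel (F i)) -> borel (\big[setU/set0]_(i <- r | P i) F i).
Proof.
by move=> bF; elim/big_ind: _ => //; [exact: borel0|exact: borelU].
Qed.

End borel_sets.

Section borel_prob_theory.
Context {R : realType} (T : topologicalType).
Implicit Types (mu nu : borel_prob R T) (A B : set T).

(** Countable additivity on the constant sequence [set0] makes a constant series converge, so its
    terms tend to 0. *)
Lemma bprob_set0 mu : mu set0 = 0.
Proof.
have s0 : series (fun=> mu set0) @ \oo -->
    mu (\bigcup_(n : nat) (set0 : set T)).
  apply: (bprob_sigma_additive (F := fun=> set0)) => [_|]; first exact: borel0.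
  by apply/trivIsetP => i j _ _ _; rewrite set0I.
have := cvg_series_cvg_0 (cvgP _ s0).
by apply: (cvg_unique (@norm_hausdorff _ _)); exact: cvg_cst.
Qed.

Lemma bprobU mu A B : borel A -> borel B -> A `&` B = set0 ->
  mu (A `|` B) = mu A + mu B.
Proof.
move=> bA bB AB0; rewrite -bigcup2E.
have sAB : series (fun n => mu (bigcup2 A B n)) @ \oo -->
    mu (\bigcup_n bigcup2 A B n).
  apply: bprob_sigma_additive => [[//|[//|n]]|]; first exact: borel0.
  by rewrite -trivIset_bigcup2.
apply: (cvg_unique (@norm_hausdorff _ _) sAB) => /=.
(* From index 2 on, the partial sums are constant. *)
rewrite -(cvg_shiftn 2%N)/=.
rewrite [X in X @ _ --> _](_ : _ = fun=> mu A + mu B); first exact: cvg_cst.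
apply/funext => n; rewrite /series/= addn2 !big_nat_recl//= big1 ?addr0//.
by move=> i _; exact: bprob_set0.
Qed.

Lemma bprobC mu B : borel B -> mu (~` B) = 1 - mu B.
Proof.
move=> bB; have := bprobU mu bB (borelC bB) (setICr B).
by rewrite setUCr bprob_setT => ->; rewrite addrC addKr.
Qed.

Lemma le_bprob mu A B : borel A -> borel B -> A `<=` B -> mu A <= mu B.
Proof.
move=> bA bB AB; rewrite -(setDUK AB) bprobU ?lerDl ?bprob_ge0//.
- exact: borelD.
- by rewrite setDIK.
Qed.

Lemma bprob_bigsetU mu (I : finType) (F : I -> set T) :
  (forall i, borel (F i)) -> trivIset setT F ->
  mu (\big[setU/set0]_i F i) = \sum_i mu (F i).
Proof.
move=> bF /trivIsetP tF; elim: (index_enum I) (index_enum_uniq I) => [_|i r IH].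
  by rewrite !big_nil bprob_set0.
rewrite cons_uniq => /andP[ir ur]; rewrite !big_cons bprobU ?IH//.
  exact: borel_bigsetU.
rewrite big_distrr/= big_seq big1// => j jr; apply: tF => //.
by apply: contraNneq ir => ->.
Qed.

(** Dynkin's pi-lambda theorem: the Borel sets on which [mu] and [nu] agree form a Dynkin system
    containing the pi-system [G]. *)
Lemma bprob_unique (G : set (set T)) mu nu : setI_closed G ->
  (forall B, G B -> mu B = nu B) -> @borel T `<=` <<s G >> -> G `<=` @borel T ->
  mu = nu.
Proof.
move=> GI Gmn bG Gb; apply: bprobP => B /bG.
rewrite -setI_closed_g_dynkin_g_sigma_algebra//.
suff : <<d G >> `<=` [set B | borel B /\ mu B = nu B] by move=> /[apply] -[].
apply: smallest_sub => [|C GC]; last by split; [exact: Gb|exact: Gmn].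
split.
- by split; [exact: borelT|rewrite !bprob_setT].
- by move=> C [bC mnC]; split; [exact: borelC|rewrite !bprobC// mnC].
- move=> F tF GF.
  have bF n : borel (F n) by have [] := GF n.
  split; first exact: borel_bigcup.
  have := @bprob_sigma_additive _ _ nu _ bF tF.
  have <- : (fun n => mu (F n)) = (fun n => nu (F n)).
    by apply/funext => n; have [] := GF n.
  exact: (cvg_unique (@norm_hausdorff _ _) (bprob_sigma_additive bF tF)).
Qed.

End borel_prob_theory.

(** * The topology of streams *)

Section stream_topology.
Variable A : finType.
Implicit Types (v w : stream A) (B O : set (stream A)) (s t : seq A).

Definition agree n v w := forall i, (i < n)%N -> v i = w i.

Definition determined n B := forall v w, agree n v w -> B v -> B w.

(** By compactness these are exactly the clopen sets; this form allows recursion on the number of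
    letters. *)
Definition finitary B := exists n, determined n B.

Lemma agree_sym n v w : agree n v w -> agree n w v.
Proof. by move=> vw i /vw. Qed.

Lemma agree_le m n v w : (m <= n)%N -> agree n v w -> agree m v w.
Proof. by move=> mn vw i im; apply: vw; exact: leq_trans mn. Qed.

Lemma determined_le m n B : (m <= n)%N -> determined m B -> determined n B.
Proof. by move=> mn dB v w vw; apply: dB; exact: agree_le vw. Qed.

Lemma determinedC n B : determined n B -> determined n (~` B).
Proof.
by move=> dB v w vw Bv Bw; apply: Bv; apply: dB Bw; exact: agree_sym.
Qed.

Lemma determinedU n B C : determined n B -> determined n C ->
  determined n (B `|` C).
Proof. by move=> dB dC v w vw [/dB|/dC] => /(_ _ vw); [left|right]. Qed.

Lemma finitaryU B C : finitary B -> finitary C -> finitary (B `|` C).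
Proof.
move=> [m dB] [n dC]; exists (maxn m n); apply: determinedU.
- by apply: determined_le dB; exact: leq_maxl.
- by apply: determined_le dC; exact: leq_maxr.
Qed.

Lemma finitaryC B : finitary B -> finitary (~` B).
Proof. by move=> [n dB]; exists n; exact: determinedC. Qed.

Lemma finitary0 : finitary set0. Proof. by exists 0%N. Qed.

Lemma mkseq_agree n v w : mkseq v n = mkseq w n <-> agree n v w.
Proof.
split=> [vw i ni|vw].
  by have := congr1 (nth (v i) ^~ i) vw; rewrite !nth_mkseq.
by apply/eq_in_map => i; rewrite mem_iota add0n => /vw.
Qed.

Lemma cylinder_mkseq n v w : cylinder (mkseq v n) w <-> agree n v w.
Proof.
rewrite /cylinder/= size_mkseq; split=> [/esym|]; first by move/mkseq_agree.
by move/mkseq_agree.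
Qed.

Lemma determined_cylinder s : determined (size s) (cylinder s).
Proof.
move=> v w vw; rewrite /cylinder/= => sv; rewrite -[RHS]sv.
by apply/mkseq_agree; exact: agree_sym.
Qed.

Lemma cylinder_finitary s : finitary (cylinder s).
Proof. by exists (size s); exact: determined_cylinder. Qed.

Lemma nbhs_streamP w B : nbhs w B <-> exists n, forall v, agree n w v -> B v.
Proof.
split=> [wB|[n nB]].
  (* This filter converges to [w] in each coordinate, hence in the product topology, so it contains
     every neighbourhood of [w]. *)
  pose F := filter_from [set: nat] (fun n => [set v | agree n w v]).
  have FF : Filter F.
    apply: filter_from_filter; first by exists 0%N.
    move=> m n _ _; exists (maxn m n) => // v wv.
    by split; apply: agree_le wv; [exact: leq_maxl|exact: leq_maxr].
  have /(_ B wB) [n _ nB] : F --> w.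
    apply: cvg_stream => n U.
    rewrite nbhs_principalE => /principal_filterP Uwn.
    by exists n.+1 => // v wv /=; rewrite -(wv n).
  by exists n.
(* Agreement on [n] letters is a finite intersection of conditions on single coordinates, each open
   because [A] is discrete. *)
suff : nbhs w [set v | agree n w v] by apply: filterS.
elim: n {nB} => [|n IH]; first by apply: filterS filterT => v _ i.
have : nbhs w [set v | v n = w n].
  apply: (@proj_stream_continuous A n w [set w n]).
  by rewrite nbhs_principalE; apply/principal_filterP.
apply: filterS2 IH => v vw vn i; rewrite ltnS leq_eqVlt => /orP[/eqP ->//|].
exact: vw.
Qed.

Lemma finitary_open B : finitary B -> open B.
Proof.
move=> [n dB]; rewrite openE => w Bw; apply/nbhs_streamP; exists n => v wv.
exact: dB Bw.
Qed.

Lemma finitary_closed B : finitary B -> closed B.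
Proof. by move=> /finitaryC /finitary_open; rewrite openC. Qed.

Lemma finitary_borel B : finitary B -> borel B.
Proof. by move=> /finitary_open; exact: open_borel. Qed.

Lemma borel_cylinder s : borel (cylinder s).
Proof. by apply: finitary_borel; exact: cylinder_finitary. Qed.

Lemma cylinder_cons a s w :
  cylinder (a :: s) w <-> w 0%N = a /\ cylinder s (tl w).
Proof.
have E : mkseq w (size s).+1 = w 0%N :: mkseq (tl w) (size s).
  by rewrite /mkseq/= -[1%N]addn0 iotaDl -map_comp.
by rewrite /cylinder/= E; split=> [[-> ->]|[-> ->]].
Qed.

(** The empty set is added to make the family closed under intersection. *)
Definition cylinders : set (set (stream A)) :=
  [set B | B = set0 \/ exists s, B = cylinder s].

(** There are countably many words, and [unpickle] enumerates them; [F] keeps those whose cylinder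
    lies in [O]. *)
Lemma open_cylinders O : open O ->
  exists2 F : nat -> set (stream A), (forall n, cylinders (F n)) &
    O = \bigcup_n F n.
Proof.
move=> oO; pose F n : set (stream A) := if unpickle n is Some s then
  if `[< cylinder s `<=` O >] then cylinder s else set0 else set0.
exists F => [n|].
  rewrite /F; case: unpickle => [s|]; last by left.
  by case: asboolP => _; [right; exists s|left].
apply/seteqP; split=> [w Ow|w [n _]]; last first.
  by rewrite /F; case: unpickle => // s; case: asboolP => // /[apply].
move: oO; rewrite openE => /(_ _ Ow)/nbhs_streamP [n nO].
exists (pickle (mkseq w n)) => //; rewrite /F pickleK asboolT.
  exact/cylinder_mkseq.
by move=> v /cylinder_mkseq /nO.
Qed.

Lemma borel_cylinders : @borel (stream A) `<=` <<s cylinders >>.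
Proof.
apply: smallest_sub; first exact: smallest_sigma_algebra.
move=> O /open_cylinders [F cF ->]; apply: sigma_algebra_bigcup => n.
exact: sub_sigma_algebra.
Qed.

(** Two cylinders are nested if the shorter word is a prefix of the longer one, and disjoint
    otherwise. *)
Lemma cylinders_setI : setI_closed cylinders.
Proof.
move=> _ _ [->|[s ->]] [->|[t ->]]; rewrite ?set0I ?setI0; try by left.
wlog st : s t / (size s <= size t)%N.
  move=> H; have [/H//|/ltnW/H] := leqP (size s) (size t).
  by rewrite setIC.
have cyl_take w : cylinder t w -> mkseq w (size s) = take (size s) t.
  by move=> wt; rewrite -[in RHS]wt /mkseq -map_take take_iota (minn_idPl st).
have [ts|ts] := eqVneq (take (size s) t) s.
  right; exists t; apply/seteqP; split=> [w []//|w wt]; split=> //.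
  by rewrite /cylinder/= cyl_take.
left; apply/seteqP; split=> // w [ws /cyl_take]; rewrite ws => ts'.
by rewrite -ts' eqxx in ts.
Qed.

Lemma stream_compact : compact [set: stream A].
Proof.
have -> : [set: stream A] =
    [set w | forall n : nat, [set: discrete_topology A] (w n)].
  by apply/seteqP; split.
apply: (@tychonoff nat (fun=> discrete_topology A) (fun=> setT)) => _.
by apply: finite_compact; exact: finite_finset.
Qed.

End stream_topology.

Lemma stream_prob_unique (R : realType) (A : finType)
    (mu nu : borel_prob R (stream A)) :
  (forall s, mu (cylinder s) = nu (cylinder s)) -> mu = nu.
Proof.
move=> mn; apply: (@bprob_unique _ _ (@cylinders A)).
- exact: cylinders_setI.
- by move=> B [->|[s ->]]; rewrite ?bprob_set0.
- exact: borel_cylinders.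
- by move=> B [->|[s ->]]; [exact: borel0|exact: borel_cylinder].
Qed.

(** * Extension of consistent weights to Borel measures *)

Section content_at.
Context {R : realType} {A : finType}.
Implicit Types (p : seq A -> R) (B C : set (stream A)).

Definition scons (a : A) (w : stream A) : stream A :=
  fun n => if n is m.+1 then w m else a.

Lemma determined_scons n B a : determined n.+1 B ->
  determined n (scons a @^-1` B).
Proof. by move=> dB v w vw; apply: dB => -[|i]//; exact: vw. Qed.

(* Splits off the first letter n times: this is the weighted number of words s
   of length n with cylinder s `<=` B, when B is determined by n letters. *)
Fixpoint content_at p n B : R :=
  if n is m.+1 then \sum_a content_at (fun s => p (a :: s)) m (scons a @^-1` B)
  else p [::] * `[< B !=set0 >]%:R.

Lemma content_at_ge0 p n B : (forall s, 0 <= p s) -> 0 <= content_at p n B.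
Proof.
elim: n p B => [|n IH] p B p0 /=; first exact: mulr_ge0.
by apply: sumr_ge0 => a _; exact: IH.
Qed.

Lemma content_at0 p n : content_at p n set0 = 0.
Proof.
elim: n p => [|n IH] p /=; last by apply: big1 => a _; rewrite preimage_set0.
by rewrite asboolF ?mulr0// => -[].
Qed.

Lemma content_atU p n B C : determined n B -> determined n C ->
  B `&` C = set0 ->
  content_at p n (B `|` C) = content_at p n B + content_at p n C.
Proof.
elim: n p B C => [|n IH] p B C dB dC BC0 /=; last first.
  rewrite -big_split/=; apply: eq_bigr => a _; rewrite preimage_setU IH//.
  - exact: determined_scons.
  - exact: determined_scons.
  - by rewrite -preimage_setI BC0 preimage_set0.
(* A set determined by no letters is empty or everything, so one of two disjoint ones is empty. *)
have [[w Bw]|/set0P/negP/negPn/eqP ->] := pselect (B !=set0); last first.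
  by rewrite set0U -[X in _ = X + _]/(content_at p 0 set0) content_at0 add0r.
have -> : C = set0.
  by apply/seteqP; split=> // v Cv; rewrite -BC0; split=> //; exact: dB Bw.
by rewrite setU0 -[X in _ = _ + X]/(content_at p 0 set0) content_at0 addr0.
Qed.

(** Consistency acts at the bottom of the recursion, where [p [::]] is split over one more letter;
    whether a set determined by no letters is empty does not change under preimage by [scons a]. *)
Lemma content_atS p n B : (forall s, p s = \sum_a p (rcons s a)) ->
  determined n B -> content_at p n.+1 B = content_at p n B.
Proof.
elim: n p B => [|n IH] p B pE dB.
  rewrite /= [p [::]]pE mulr_suml; apply: eq_bigr => a _; congr (_ * _%:R).
  congr (nat_of_bool _); apply: asbool_equiv_eq; split=> -[w Bw].
    by exists (scons a w).
  by exists w; exact: dB Bw.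
apply: eq_bigr => a _; apply: IH; last exact: determined_scons.
by move=> s; rewrite pE.
Qed.

Lemma content_at_le p m n B : (forall s, p s = \sum_a p (rcons s a)) ->
  (m <= n)%N -> determined m B -> content_at p n B = content_at p m B.
Proof.
move=> pE mn dB; rewrite -(subnKC mn); elim: (n - m)%N => [|k IH].
  by rewrite addn0.
by rewrite addnS content_atS//; apply: determined_le dB; exact: leq_addr.
Qed.

Lemma content_at_cylinder (a0 : A) p s :
  content_at p (size s) (cylinder s) = p s.
Proof.
elim: s p => [|a s IH] p /=.
  (* The constant stream at [a0] witnesses that the cylinder of the empty word is non-empty. *)
  by rewrite asboolT ?mulr1//; exists (fun=> a0).
rewrite (bigD1 a)//= big1 ?addr0 => [|b ba].
  rewrite -[RHS](IH (fun s => p (a :: s))); congr content_at.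
  by apply/seteqP; split=> w => [/cylinder_cons[]//|ws]; exact/cylinder_cons.
rewrite [X in content_at _ _ X](_ : _ = set0) ?content_at0//.
by apply/seteqP; split=> // w /cylinder_cons [/eqP]; rewrite (negPf ba).
Qed.

End content_at.

(** A consistent family of finite-dimensional marginals in the sense of Kolmogorov. *)
Record stream_weight (R : realType) (A : finType) := StreamWeight {
  sweight :> seq A -> R;
  sweight_ge0 : forall s, 0 <= sweight s;
  sweight_nil : sweight [::] = 1;
  sweight_rcons : forall s, sweight s = \sum_a sweight (rcons s a)
}.

(* The base point a0 is needed because the library's measurable types are
   pointed, whereas stream A is empty when A is. *)
Definition pstream (A : finType) (a0 : A) : Type := stream A.

HB.instance Definition _ (A : finType) (a0 : A) :=
  Topological.copy (pstream a0) (stream A).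
HB.instance Definition _ (A : finType) (a0 : A) :=
  isPointed.Build (pstream a0) (fun=> a0).
(** The [measurable] sets of [pstream a0] are the clopen ones, the algebra from which the
    Caratheodory extension starts. *)
HB.instance Definition _ (A : finType) (a0 : A) :=
  isAlgebraOfSets.Build default_measure_display (pstream a0)
    (@finitary0 A) (@finitaryU A) (@finitaryC A).

(** * The premeasure on clopen sets *)

Section stream_content.
Context {R : realType} {A : finType} (a0 : A).
Variable p : stream_weight R A.
Local Notation T := (pstream a0).
Implicit Types (B C : set T).

(** [cid] picks some number of letters determining [B]; by [stream_contentE] every such number gives
    the same value. *)
Definition stream_content B : \bar R :=
  if pselect (finitary B) is left fB then (content_at p (projT1 (cid fB)) B)%:E
  else 0%E.

Lemma stream_contentE n B : determined n B ->
  stream_content B = (content_at p n B)%:E.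
Proof.
move=> dB; rewrite /stream_content; case: pselect => [fB|[]]; last by exists n.
case: cid => m /= dmB; congr EFin.
rewrite -(content_at_le (@sweight_rcons _ _ p) (leq_maxl m n))//.
by rewrite (content_at_le (@sweight_rcons _ _ p) (leq_maxr m n)).
Qed.

Lemma stream_content_ge0 B : (0 <= stream_content B)%E.
Proof.
rewrite /stream_content; case: pselect => // fB.
by rewrite lee_fin content_at_ge0//; exact: sweight_ge0.
Qed.

Lemma stream_content0 : stream_content set0 = 0%E.
Proof. by rewrite (@stream_contentE 0)// content_at0. Qed.

Lemma stream_contentU B C : finitary B -> finitary C -> B `&` C = set0 ->
  (stream_content (B `|` C) = stream_content B + stream_content C)%E.
Proof.
move=> [m dmB] [n dnC] BC0.
have dB := determined_le (leq_maxl m n) dmB.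
have dC := determined_le (leq_maxr m n) dnC.
rewrite (stream_contentE dB) (stream_contentE dC).
by rewrite (stream_contentE (determinedU dB dC)) content_atU.
Qed.

Lemma stream_content_semi_additive :
  measure_function.semi_additive (stream_content : set T -> \bar R).
Proof.
move=> F n mF tF _; elim: n => [|n IH].
  by rewrite !big_ord0 stream_content0.
rewrite !big_ord_recr/= -IH stream_contentU//.
- rewrite -[finitary _]/(measurable (_ : set T)).
  by apply: bigsetU_measurable => i _; exact: mF.
- exact: mF.
- by apply: (@trivIset_bigsetUI _ predT) => //; rewrite /predT/= trueE.
Qed.

HB.instance Definition _ := isContent.Build _ T R stream_content
  stream_content_ge0 stream_content_semi_additive.

(** A clopen set is compact, so a countable cover by clopen sets has a finite subcover, and finite
    subadditivity suffices. *)
Lemma stream_content_sigma_subadditive :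
  measurable_subset_sigma_subadditive (stream_content : set T -> \bar R).
Proof.
move=> B F mF mB BF.
have : compact (B : set T) := @subclosed_compact (stream A) B setT
  (finitary_closed mB) (@stream_compact A) (@subsetT _ _).
rewrite compact_cover => /(_ nat setT F) [n _|w /BF//|D _ BD].
  by apply: finitary_open; exact: mF.
have /finite_seqP [s Ds] := @finite_fset _ D; rewrite {}Ds in BD.
(* [N] exceeds all indices of the finite subcover, so the first [N] sets cover [B]. *)
pose N := (\max_(i <- s) i).+1%N.
apply: (@le_trans _ _ (\sum_(i < N) stream_content (F i))%E).
  apply: (@content_subadditive _ _ _ stream_content B F N) => //.
  move=> w /BD [i iD Fiw].
  rewrite -bigcup_mkord; exists i => //=.
  by rewrite /N ltnS leq_bigmax_seq.
rewrite -(big_mkord xpredT (fun i => stream_content (F i))).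
by apply: nneseries_lim_ge => i *; exact: stream_content_ge0.
Qed.

HB.instance Definition _ := Content_SigmaSubAdditive_isMeasure.Build _ R T
  stream_content stream_content_sigma_subadditive.

End stream_content.

(** The Caratheodory extension is a measure on the right-hand side, which is thereby identified with
    the Borel sets. *)
Lemma borel_finitary (A : finType) : @borel (stream A) = <<s @finitary A >>.
Proof.
apply/seteqP; split=> [B /borel_cylinders|].
  apply: sub_smallest2r => [|_ [->|[s ->]]].
  - exact: smallest_sigma_algebra.
  - exact: finitary0.
  - exact: cylinder_finitary.
apply: smallest_sub; first exact: smallest_sigma_algebra.
exact: finitary_borel.
Qed.

(** * Caratheodory extension and regularity *)

Section stream_measure.
Local Open Scope ereal_scope.
Context {R : realType} {A : finType} (a0 : A).
Variable p : stream_weight R A.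
Local Notation T := (pstream a0).
Local Notation mu := (stream_content (a0 := a0) p).
Local Notation mu' := (measure_extension mu).
Implicit Types (B C : set T).

Lemma stream_extensionE n B : determined n B -> mu' B = (content_at p n B)%:E.
Proof.
move=> dB; rewrite /measure_extension measurable_mu_extE; last by exists n.
exact: stream_contentE.
Qed.

Lemma stream_extension_cylinder s : mu' (cylinder s) = (p s)%:E.
Proof.
rewrite -(content_at_cylinder a0 p s); apply: stream_extensionE.
exact: determined_cylinder.
Qed.

Lemma stream_extension_setT : mu' setT = 1.
Proof.
rewrite (_ : setT = cylinder [::]) ?stream_extension_cylinder ?sweight_nil//.
by apply/seteqP; split.
Qed.

Lemma stream_extension_fin B : mu' B \is a fin_num.
Proof.
rewrite ge0_fin_numE ?measure_ge0//; apply: (@le_lt_trans _ _ (mu' setT)).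
  by apply: le_mu_ext; exact: subsetT.
by rewrite stream_extension_setT ltry.
Qed.

Definition stream_prob_fun (B : set (stream A)) : R :=
  if `[< borel B >] then fine (mu' B) else 0%R.

Lemma stream_prob_funE B : borel B -> (stream_prob_fun B)%:E = mu' B.
Proof.
by move=> bB; rewrite /stream_prob_fun asboolT// fineK// stream_extension_fin.
Qed.

Lemma stream_prob_nonborel B : ~ borel B -> stream_prob_fun B = 0%R.
Proof. by move=> nB; rewrite /stream_prob_fun asboolF. Qed.

Lemma stream_prob_ge0 B : (0 <= stream_prob_fun B)%R.
Proof. by rewrite /stream_prob_fun; case: ifP => // _; rewrite fine_ge0. Qed.

Lemma stream_prob_setT : stream_prob_fun setT = 1%R.
Proof.
apply: EFin_inj; rewrite stream_prob_funE ?stream_extension_setT//.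
exact: borelT.
Qed.

Lemma stream_prob_sigma_additive (F : (set (stream A))^nat) :
  (forall n, borel (F n)) -> trivIset setT F ->
  (series (fun n => stream_prob_fun (F n)) @ \oo -->
    stream_prob_fun (\bigcup_n F n))%classic.
Proof.
move=> bF tF.
suff : EFin (series (fun n => stream_prob_fun (F n)) n) @[n --> \oo] -->
    (stream_prob_fun (\bigcup_n F n))%:E by move=> /fine_cvgP[].
rewrite stream_prob_funE; last exact: borel_bigcup.
rewrite [X in X @ _ --> _](_ : _ = fun n => \sum_(0 <= i < n) mu' (F i)).
  have mF n : <<s @finitary A >> (F n) by rewrite -borel_finitary.
  apply: (@measure_semi_sigma_additive _ _ _ (measure_extension mu) F) => //.
  exact: sigma_algebra_bigcup.
apply/funext => n; rewrite /series/= -sumEFin.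
by apply: eq_bigr => i _; rewrite stream_prob_funE.
Qed.

Definition stream_prob : borel_prob R (stream A) :=
  BorelProb stream_prob_nonborel stream_prob_ge0 stream_prob_setT
    stream_prob_sigma_additive.

Lemma stream_prob_cylinder s : stream_prob (cylinder s) = p s.
Proof.
apply: EFin_inj; rewrite stream_prob_funE ?stream_extension_cylinder//.
exact: borel_cylinder.
Qed.

(** The extension at [B] is an infimum over countable covers by clopen sets; the union of a cover
    within [e] of it is the required open set. *)
Lemma stream_prob_outer_regular (B : set (stream A)) (e : R) : borel B ->
  (0 < e)%R ->
  exists O, [/\ open O, B `<=` O & (stream_prob O < stream_prob B + e)%R].
Proof.
move=> bB e0.
have [_ [F [mF BF] <-]] := lb_ereal_inf_adherent e0 (stream_extension_fin B).
move=> Fe; have oF : open (\bigcup_n F n : set (stream A)).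
  by apply: bigcup_open => n _; apply: finitary_open; exact: mF.
exists (\bigcup_n F n); split=> //; rewrite -lte_fin EFinD.
rewrite !stream_prob_funE//; last exact: open_borel.
(* [F] also covers its own union, so its total content bounds the measure of that union. *)
apply: le_lt_trans Fe; apply: ereal_inf_lbound.
by exists F; split.
Qed.

(** Outer regularity of the complement: if an open [U] contains the complement of [B] with excess
    below [e], then the complement of [U] is a compact subset of [B] missing less than [e]. *)
Lemma stream_prob_radon : radon stream_prob.
Proof.
move=> B bB; set S := [set _ | _ in _].
have ubS : ubound S (stream_prob B).
  by move=> _ [K [_ bK KB] <-]; exact: le_bprob.
have nS : S !=set0.
  exists (stream_prob set0), set0; split=> //; first exact: compact0.
  exact: borel0.
apply/eqP; rewrite eq_le ge_sup// andbT; apply/ler_addgt0Pr => e e0.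
have [U [oU BU Ue]] := stream_prob_outer_regular (borelC bB) e0.
have bU := open_borel oU.
have : (stream_prob (~` U) <= sup S)%R.
  apply: ub_le_sup; first by exists (stream_prob B).
  exists (~` U) => //; split; last by rewrite -[B]setCK; exact: subsetC.
    apply: subclosed_compact (@stream_compact A) (@subsetT _ _).
    exact: open_closedC.
  exact: borelC.
rewrite bprobC//; move: Ue; rewrite bprobC//; lra.
Qed.

End stream_measure.

(** Over an empty [A] the whole space is empty, of mass 0 rather than 1. The letter obtained serves
    as base point of [pstream]. *)
Lemma stream_prob_inhabited (R : realType) (A : finType)
    (w : borel_prob R (stream A)) : inhabited A.
Proof.
have /set0P [v _] : [set: stream A] != set0.
  apply/eqP => T0; have := bprob_setT w.
  by rewrite T0 bprob_set0 => /eqP; rewrite eq_sym oner_eq0.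
exact: (inhabits (v 0%N)).
Qed.

Lemma stream_weight_inhabited (R : realType) (A : finType)
  (p : stream_weight R A) : inhabited A.
Proof.
have [a _|A0] := pickP (@predT A); first exact: (inhabits a).
have := sweight_rcons p [::]; rewrite sweight_nil big_pred0// => /eqP.
by rewrite oner_eq0.
Qed.

Lemma cylinder_split (A : finType) (s : seq A) :
  cylinder s = \big[setU/set0]_a cylinder (rcons s a).
Proof.
rewrite -bigcup_seq/=; apply/seteqP; split=> w.
  move=> ws; exists (w (size s)); first by rewrite /= mem_index_enum.
  by rewrite /cylinder/= size_rcons mkseqS; congr rcons.
move=> [a _]; rewrite /cylinder/= size_rcons mkseqS.
by move=> /eqP; rewrite eqseq_rcons => /andP[/eqP].
Qed.

Section weight_of_prob.
Context {R : realType} {A : finType} (w : borel_prob R (stream A)).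

Lemma prob_rcons s : w (cylinder s) = \sum_a w (cylinder (rcons s a)).
Proof.
rewrite [in LHS]cylinder_split bprob_bigsetU//.
  by move=> a; exact: borel_cylinder.
move=> a b _ _ [v []]; rewrite /cylinder/= !size_rcons => -> /eqP.
by rewrite eqseq_rcons eqxx/= => /eqP.
Qed.

Lemma prob_nil : w (cylinder [::]) = 1.
Proof.
by rewrite -(bprob_setT w); congr (w _); apply/seteqP; split.
Qed.

Definition weight_of_prob : stream_weight R A :=
  @StreamWeight _ _ (fun s => w (cylinder s)) (fun s => bprob_ge0 w _)
    prob_nil prob_rcons.

(** By uniqueness on cylinders, every measure is the Caratheodory extension of its own weights. *)
Lemma stream_radon : radon w.
Proof.
have [a0] := stream_prob_inhabited w.
rewrite -(@stream_prob_unique _ _ (stream_prob a0 weight_of_prob) w).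
  exact: stream_prob_radon.
by move=> s; rewrite stream_prob_cylinder.
Qed.

End weight_of_prob.

Lemma stream_prob_exists (R : realType) (A : finType) (p : stream_weight R A) :
  exists mu : borel_prob R (stream A), forall s, mu (cylinder s) = p s.
Proof.
have [a0] := stream_weight_inhabited p.
exists (stream_prob a0 p); exact: stream_prob_cylinder.
Qed.

(** * Disintegration over the first letter *)

Section seval.
Context {R : realType}.

(* The affine extension of f : X -> R to subprobability-weighted points. *)
Definition seval X (f : X -> R) (t : summand X) : R :=
  if t is Some (p, x) then p%:num * f x else 0.

Lemma eq_seval X (f g : X -> R) : f =1 g -> seval f =1 seval g.
Proof. by move=> fg [[p x]|] //=; rewrite fg. Qed.

Lemma seval_cst1 X (t : summand X) : seval (fun=> 1) t = weight t.
Proof. by case: t => [[p x]|] //=; rewrite mulr1. Qed.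

Lemma seval_smap X Y (h : X -> Y) (f : Y -> R) t :
  seval f (smap h t) = seval (f \o h) t.
Proof. by case: t => [[]|]. Qed.

Lemma seval_sum X (I : finType) (f : I -> X -> R) t :
  seval (fun x => \sum_i f i x) t = \sum_i seval (f i) t.
Proof. by case: t => [[p x]|] /=; rewrite ?mulr_sumr// big1. Qed.

Lemma seval_sscale X (f : X -> R) r t : 0 <= r ->
  seval f (sscale r t) = r * seval f t.
Proof.
rewrite le_eqVlt => /orP[/eqP <-|r0]; first by rewrite sscale0 mul0r.
case: t => [[p x]|]; last by rewrite mulr0.
by have [q qE ->] := sscaleE p x r0; rewrite /= qE mulrA.
Qed.

Definition real_affine (X : convType R) (f : X -> R) :=
  forall (r : {i01 R}) x y, f (x <|r|> y) = r%:num * f x + (1 - r%:num) * f y.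

Lemma seval_sadd (X : convType R) (f : X -> R) t u : real_affine f ->
  seval f (sadd t u) = seval f t + seval f u.
Proof.
move=> fa; case: t u => [[p x]|] [[q y]|] //=; rewrite ?addr0 ?add0r//.
by rewrite fa /=; field; rewrite gt_eqF.
Qed.

Lemma seval_conv (A : finType) (X : convType R) (f : X -> R) (r : {i01 R})
    (t u : coprod A X) a : real_affine f ->
  seval f ((t <|r|> u) a) =
    r%:num * seval f (t a) + (1 - r%:num) * seval f (u a).
Proof.
by move=> fa; rewrite /= /coprod_conv_fun seval_sadd// !seval_sscale// subr_ge0.
Qed.

(** Obtained by applying [seval f] to [copairE], where the total weight is 1; it replaces the chosen
    point [copair g t] by a finite sum. *)
Lemma seval_copair (A : finType) (X Y : convType R) (g : A -> X -> Y)
    (f : Y -> R) (t : coprod A X) : real_affine f ->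
  f (copair g t) = \sum_a seval (f \o g a) (t a).
Proof.
move=> fa; have := congr1 (seval f) (copairE g t); rewrite /= mul1r => <-.
rewrite /copair_sum (big_morph _ (fun t u => seval_sadd t u fa) erefl).
by apply: eq_bigr => a _; rewrite seval_smap.
Qed.

Lemma bprob_affine (T : topologicalType) (B : set T) :
  real_affine (fun mu : borel_prob R T => mu B).
Proof. by []. Qed.

End seval.

(** * Measures on the product of the alphabet and the stream space *)

Section disintegration.
Context {R : realType} {A : finType}.
Local Notation dA := (discrete_topology A).
Local Notation S := (stream A).
Local Notation P := (borel_prob R S).
Local Notation Q := (borel_prob R (dA * S)%type).
Implicit Types (B : set S) (w : Q) (t : @coprod R A P).

(** A summand is read as a subprobability measure, [None] being the zero measure; this avoids
    dividing by weights. *)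
Definition mass (u : @summand R P) B : R := seval (fun mu : P => mu B) u.

(** The cylinder of the empty word recovers the weight; cancelling this weight when it is positive
    recovers the measure. *)
Lemma mass_inj (u u' : @summand R P) :
  (forall s, mass u (cylinder s) = mass u' (cylinder s)) -> u = u'.
Proof.
have massE (v : @summand R P) : mass v (cylinder [::]) = weight v.
  by rewrite -seval_cst1; apply: eq_seval => mu; exact: prob_nil.
move=> uu'; apply: summandP; first by rewrite -!massE.
move=> p q mu nu uE u'E pq; apply: stream_prob_unique => s.
have := uu' s; rewrite uE u'E /mass/= pq; apply: mulfI.
by rewrite gt_eqF.
Qed.

Definition slice (a : A) B : set (dA * S) := [set x | x.1 = a /\ B x.2].

Lemma borel_slice a B : borel B -> borel (slice a B).
Proof.
move=> bB; apply: (@borelI (dA * S)%type (fst @^-1` [set a]) (snd @^-1` B)).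
  apply: (@continuous_borel_map (dA * S)%type dA fst) => [x|].
    exact: cvg_fst.
  by apply: open_borel; exact: discrete_open.
by apply: (@continuous_borel_map (dA * S)%type S snd) => // x; exact: cvg_snd.
Qed.

Lemma slice_bigcup a (F : (set S)^nat) :
  slice a (\bigcup_n F n) = \bigcup_n slice a (F n).
Proof.
apply/seteqP; split=> x; first by move=> [xa [n _ Fn]]; exists n.
by move=> [n _ [xa Fn]]; split => //; exists n.
Qed.

Lemma trivIset_slice a (F : (set S)^nat) :
  trivIset setT F -> trivIset setT (fun n => slice a (F n)).
Proof.
by move=> tF i j _ _ [x [[_ Fi] [_ Fj]]]; apply: tF => //; exists x.2.
Qed.

Lemma slice_preimage_pair a b B : (pair b : S -> dA * S) @^-1` slice a B =
  if b == a then B else set0.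
Proof.
apply/seteqP; case: eqP => [->|ba]; split=> v //; first by case.
by move=> [].
Qed.

Lemma slice_split (B : set (dA * S)) :
  B = \big[setU/set0]_(a : A) slice a ((pair (a : dA) : S -> dA * S) @^-1` B).
Proof.
rewrite -bigcup_seq/=; apply/seteqP; split=> -[b v].
  by move=> Bbv; exists b => //=; rewrite mem_index_enum.
by move=> [a _ []]/= ->.
Qed.

Lemma trivIset_slices (F : A -> set S) : trivIset setT (fun a => slice a (F a)).
Proof. by move=> a b _ _ [x [[<- _] [<- _]]]. Qed.

Section conditional.
Variables (w : Q) (a : A).
Hypothesis w0 : 0 < w (slice a setT).

(** Conditioning on the first component being [a]; for a pushforward along [hdtl] this is the
    normalised measure of the explicit formula. *)
Definition cond_fun B :=
  if `[< borel B >] then w (slice a B) / w (slice a setT) else 0.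

Lemma cond_funE B : borel B -> cond_fun B = w (slice a B) / w (slice a setT).
Proof. by move=> bB; rewrite /cond_fun asboolT. Qed.

Lemma cond_nonborel B : ~ borel B -> cond_fun B = 0.
Proof. by move=> nB; rewrite /cond_fun asboolF. Qed.

Lemma cond_ge0 B : 0 <= cond_fun B.
Proof.
by rewrite /cond_fun; case: ifP => // _; rewrite divr_ge0 ?bprob_ge0.
Qed.

Lemma cond_setT : cond_fun setT = 1.
Proof. by rewrite cond_funE ?divff ?gt_eqF//; exact: borelT. Qed.

Lemma cond_sigma_additive (F : (set S)^nat) :
  (forall n, borel (F n)) -> trivIset setT F ->
  series (fun n => cond_fun (F n)) @ \oo --> cond_fun (\bigcup_n F n).
Proof.
move=> bF tF; rewrite cond_funE; last exact: borel_bigcup.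
rewrite [X in X @ _ --> _](_ : _ =
    fun n => series (fun n => w (slice a (F n))) n / w (slice a setT)).
  rewrite slice_bigcup; apply: cvgM; last exact: cvg_cst.
  apply: bprob_sigma_additive => [n|]; first exact: borel_slice.
  exact: trivIset_slice.
apply/funext => n; rewrite /series/= mulr_suml.
by apply: eq_bigr => i _; rewrite cond_funE.
Qed.

Definition cond : P :=
  BorelProb cond_nonborel cond_ge0 cond_setT cond_sigma_additive.

End conditional.

(** Hides the case distinction between null and non-null slices, so that later arguments compare
    masses only. *)
Lemma slice_summand w a : exists u : @summand R P,
  forall B, borel B -> mass u B = w (slice a B).
Proof.
have [w0|] := ltP 0 (w (slice a setT)).
  exists (Some (PosNum w0, cond w0)) => B bB.
  by rewrite /mass/= cond_funE// mulrCA divff ?mulr1// gt_eqF.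
move=> w0; exists None => B bB; apply/eqP; rewrite /mass/= eq_le bprob_ge0/=.
apply: le_trans w0; apply: le_bprob.
- exact: borel_slice.
- by apply: borel_slice; exact: borelT.
- by move=> x [].
Qed.

Definition disint_fun w a := projT1 (cid (slice_summand w a)).

Lemma mass_disint w a B : borel B -> mass (disint_fun w a) B = w (slice a B).
Proof. by rewrite /disint_fun; case: cid => u /= /[apply]. Qed.

Lemma weight_mass (u : @summand R P) : weight u = mass u setT.
Proof. by rewrite -seval_cst1; apply: eq_seval => mu; rewrite bprob_setT. Qed.

Lemma disint_subproof w : \sum_a weight (disint_fun w a) = 1.
Proof.
have wE a : weight (disint_fun w a) = w (slice a setT).
  by rewrite weight_mass mass_disint//; exact: borelT.
under eq_bigr do rewrite wE.
rewrite -(bprob_setT w) [in RHS](slice_split setT) bprob_bigsetU//.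
- by move=> a; apply: borel_slice; exact: borelT.
- exact: trivIset_slices.
Qed.

Definition disint w : coprod A P := Coprod (disint_subproof w).

Lemma copair_pushE t (B : set (dA * S)) : borel B ->
  copair_push t B = \sum_a mass (t a) ((pair (a : dA) : S -> dA * S) @^-1` B).
Proof.
move=> bB; rewrite /copair_push (seval_copair _ _ (bprob_affine B)).
by apply: eq_bigr => a _; apply: eq_seval => mu /=; rewrite pushE_subproof.
Qed.

Lemma mass_set0 (u : @summand R P) : mass u set0 = 0.
Proof. by case: u => [[p mu]|] //; rewrite /mass/= bprob_set0 mulr0. Qed.

Lemma copair_push_slice t a B : borel B ->
  copair_push t (slice a B) = mass (t a) B.
Proof.
move=> bB; rewrite copair_pushE; last exact: borel_slice.
rewrite (bigD1 a)//= big1 ?addr0 => [|b /negPf ba].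
  by rewrite slice_preimage_pair eqxx.
by rewrite slice_preimage_pair ba mass_set0.
Qed.

Lemma disintK : cancel disint (@copair_push R A).
Proof.
move=> w; apply: bprobP => B bB; rewrite copair_pushE//.
have bBa (a : dA) : borel ((pair a : S -> dA * S) @^-1` B).
  by apply: (continuous_borel_map (@pair_continuous A a)).
under eq_bigr do rewrite mass_disint//.
rewrite [in RHS](slice_split B) bprob_bigsetU//; last exact: trivIset_slices.
by move=> a; exact: borel_slice.
Qed.

Lemma copair_pushK : cancel (@copair_push R A) disint.
Proof.
move=> t; apply: coprodP => a; apply: mass_inj => s.
have bs := borel_cylinder s.
by rewrite mass_disint// copair_push_slice.
Qed.

Lemma copair_push_affine : affine (@copair_push R A).
Proof. by apply: copair_affine => a; exact: push_affine. Qed.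

(** The inverse of an affine bijection is affine. *)
Lemma disint_affine : affine disint.
Proof.
move=> r w w'; rewrite -[in LHS](disintK w) -[in LHS](disintK w').
by rewrite -copair_push_affine copair_pushK.
Qed.

Lemma disint_push_affine : affine (disint \o @push_hdtl R A).
Proof. by move=> r w w'; rewrite /= /push_hdtl push_affine disint_affine. Qed.

(** The preimage of [slice a (cylinder s)] under [hdtl] is [cylinder (a :: s)]: the comagma
    structure peels off the first letter. *)
Lemma mass_disint_push (w : P) a s :
  mass (disint (push_hdtl w) a) (cylinder s) = w (cylinder (a :: s)).
Proof.
rewrite mass_disint; last exact: borel_cylinder.
rewrite pushE; last by apply: borel_slice; exact: borel_cylinder.
by congr (w _); apply/seteqP; split=> v /cylinder_cons.
Qed.

End disintegration.

(** * Finality *)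

Section behaviour.
Context {R : realType} {A : finType} (C : comagma R A).
Implicit Types (x : C) (s : seq A).

(* The mass that the image of x in the final comagma gives to cylinder s. *)
Fixpoint behaviour s x : R :=
  if s is a :: s' then seval (behaviour s') (costruct x a) else 1.

Lemma behaviour_affine s : real_affine (behaviour s).
Proof.
elim: s => [|a s IH] r x y /=; first by rewrite !mulr1 subrKC.
by rewrite costruct_affine seval_conv.
Qed.

Lemma behaviour_ge0 x s : 0 <= behaviour s x.
Proof.
elim: s x => //= a s IH x; case: (costruct x a) => [[p y]|] //=.
exact: mulr_ge0.
Qed.

Lemma behaviour_rcons x s : behaviour s x = \sum_a behaviour (rcons s a) x.
Proof.
elim: s x => [|b s IH] x /=.
  rewrite -[LHS](weight_summands (costruct x)).
  by apply: eq_bigr => a _; rewrite -seval_cst1.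
by rewrite (eq_seval IH) seval_sum.
Qed.

Definition behaviour_weight x : stream_weight R A :=
  @StreamWeight R A (behaviour^~ x) (behaviour_ge0 x) erefl (behaviour_rcons x).

Definition unfold x : borel_prob R (stream A) :=
  projT1 (cid (stream_prob_exists (behaviour_weight x))).

Lemma unfold_cylinder x s : unfold x (cylinder s) = behaviour s x.
Proof. by rewrite /unfold; case: cid => mu /= ->. Qed.

Lemma unfold_affine : affine unfold.
Proof.
move=> r x y; apply: stream_prob_unique => s.
by rewrite bprob_affine !unfold_cylinder behaviour_affine.
Qed.

End behaviour.

Lemma final_disint (R : realType) (A : finType) :
  final_comagma (Comagma (@disint_push_affine R A)).
Proof.
move=> C; exists (@unfold R A C); split.
  split=> [|x]; first exact: unfold_affine.
  apply: coprodP => a; apply: mass_inj => s.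
  (* On [cylinder s], the two sides of the homomorphism equation reduce to the recursive clause of
     [behaviour] at [a :: s]. *)
  rewrite [LHS]mass_disint_push unfold_cylinder /mass/= seval_smap.
  by apply: eq_seval => y /=; rewrite unfold_cylinder.
(* Uniqueness: by induction on the word, the homomorphism equation forces the values of [h x] on
   cylinders to obey the recursion defining [behaviour]. *)
move=> h [_ hE]; apply/funext => x; apply: stream_prob_unique => s.
rewrite unfold_cylinder; elim: s x => [|a s IH] x; first by rewrite prob_nil.
rewrite -mass_disint_push.
rewrite -[disint _]/(@costruct _ _ (Comagma (@disint_push_affine R A)) (h x)).
rewrite hE /mass/= seval_smap; exact: eq_seval.
Qed.

(** As a two-sided inverse of the canonical map, [phi] is uniquely determined, so the existential
    leaves no freedom in the comagma structure. *)
Theorem proposition79 (R : realType) (A : finType) :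
  (forall w : borel_prob R (stream A), radon w) /\
  exists phi : borel_prob R (discrete_topology A * stream A)%type ->
      coprod A (borel_prob R (stream A)),
    [/\ affine phi,
      affine (@copair_push R A),
      cancel phi (@copair_push R A),
      cancel (@copair_push R A) phi &
      exists gamma_affine : affine (phi \o @push_hdtl R A),
        final_comagma (Comagma gamma_affine) /\
        forall (w : borel_prob R (stream A)) (a : A),
          let wa := w (cylinder [:: a]) in
          (wa = 0 -> (phi \o @push_hdtl R A) w a = None) /\
          (wa <> 0 -> exists (p : {posnum R}) (mu : borel_prob R (stream A)),
            [/\ (phi \o @push_hdtl R A) w a = Some (p, mu),
              p%:num = wa &
              forall nu : borel_prob R (stream A),
                (forall s : seq A,
                  nu (cylinder s) = w (cylinder (a :: s)) / wa) <->
                nu = mu])].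
Proof.
split; first exact: stream_radon.
exists (@disint R A); split.
- exact: disint_affine.
- exact: copair_push_affine.
- exact: disintK.
- exact: copair_pushK.
exists (@disint_push_affine R A); split; first exact: final_disint.
move=> w a wa.
have wE s : mass (disint (push_hdtl w) a) (cylinder s) = w (cylinder (a :: s)).
  exact: mass_disint_push.
have wE0 : weight (disint (push_hdtl w) a) = wa.
  by rewrite -[wa]wE -seval_cst1; apply: eq_seval => mu; rewrite prob_nil.
split=> [wa0|wa0]; first by apply: weight_eq0; rewrite wE0.
move: wE wE0; rewrite [(_ \o _) w]/=.
case: (disint (push_hdtl w) a) => [[p mu]|] wE pwa; last by case: wa0.
exists p, mu; split=> // nu.
(* The mass of [Some (p, mu)] is [p] times [mu], and [p] equals [wa]. *)
have muE s : mu (cylinder s) = w (cylinder (a :: s)) / wa.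
  by rewrite -wE -pwa /mass/= mulrC mulKf// gt_eqF.
by split=> [nuE|-> //]; apply: stream_prob_unique => s; rewrite nuE muE.
Qed.
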